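(* Let $\mathcal{A}_{\mathcal{D}}$ be an ordered Desargues affine plane, let $\ell$ be a line of $\mathcal{A}_{\mathcal{D}}$ (with its betweenness relation), let $O\neq I$ be two points of $\ell$, and let $\mathbf{K}=(\ell,+,\ast)$ be the skew-field constructed over $\ell$ with zero $O$ and one $I$. Then $\mathbf{K}$, together with the sets $\mathbf{K}_+$ and $\mathbf{K}_-$ determined by the betweenness relation of $\ell$, is an ordered skew-field.
   Context: An affine plane consists of a set $\mathcal{P}$ of points and a set $\mathcal{L}$ of lines (subsets of $\mathcal{P}$) such that: any two distinct points lie on exactly one line; for each line $\ell$ and each point $P\notin\ell$ there is exactly one line through $P$ disjoint from $\ell$; there exist three non-collinear points. Two lines are parallel ($\parallel$) if they are equal or disjoint. The line through distinct points $A,B$ is written $AB$. A Desargues affine plane is an affine plane satisfying Desargues' axiom: if $k,l,m$ are three pairwise distinct lines which are either mutually parallel or pass through a common point $S$, and $A,A'\in k$, $B,B'\in l$, $C,C'\in m$ (all different from $S$ in the concurrent case) satisfy $AB\parallel A'B'$ and $BC\parallel B'C'$, then $AC\parallel A'C'$. An ordered line is a line $\ell$ with a ternary betweenness relation $[A,B,C]$ (''$B$ lies between $A$ and $C$''), holding only for mutually distinct points of $\ell$, such that: (Lo.1) $[A,B,C]\Rightarrow[C,B,A]$; (Lo.2) for mutually distinct $A,B,C\in\ell$ exactly one of $[A,B,C]$, $[B,C,A]$, $[C,A,B]$ holds; (Lo.3) for mutually distinct $A,B,C,D\in\ell$, $[A,B,C]$ and $[B,C,D]$ imply $[A,B,D]$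 and $[A,C,D]$; (Lo.4) for mutually distinct $A,B,C,D\in\ell$, $[A,B,C]$ and $[C,B,D]$ imply $[D,A,B]$ or $[A,D,B]$. A parallel projection from a line $\ell_1$ to a line $\ell_2$ is a map $P_p:\ell_1\to\ell_2$ determined by a line $d$ parallel to neither $\ell_1$ nor $\ell_2$: $P_p(A)$ is the intersection of $\ell_2$ with the line through $A$ parallel to $d$. A Desargues affine plane is ordered if every line is equipped with a betweenness relation making it an ordered line, and every parallel projection $P_p:\ell_1\to\ell_2$ preserves or reverses the ordering, i.e. $[A,B,C]$ implies $[P_p(A),P_p(B),P_p(C)]$ or $[P_p(C),P_p(B),P_p(A)]$ (these two being equivalent by (Lo.1)). Skew-field over a line: fix a line $\ell$ and distinct points $O,I\in\ell$. For $A,C\in\ell$ choose a point $B\notin\ell$. Addition: let $D$ be the intersection of the line through $B$ parallel to $\ell$ with the line through $A$ parallel to $OB$; then $A+C$ is the intersection with $\ell$ of the line through $D$ parallel to $CB$. Multiplication: let $E$ be the intersection of the line through $A$ parallel to $IB$ with the line $OB$; then $A\ast C$ is the intersection with $\ell$ of the line through $E$ parallel to $BC$. It is known that these points do not depend on $B$ and that $\mathbf{K}=(\ell,+,\ast)$ is a skew-field with zero $O$ and one $I$. Put $\mathbf{K}_+=\{I\}\cup\{X\in\ell : [O,X,I]\text{ or }[O,I,X]\}$ and $\mathbf{K}_-=\{X\in\ell : [X,O,I]\}$. A skew-field $K$ with subsets $K_+,K_-$ is an ordered skew-field if (1) $K=K_-\cup\{0_K\}\cup K_+$ and the sets $K_-,\{0_K\},K_+$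 are pairwise disjoint; (2) $k_1+k_2\in K_+$ for all $k_1,k_2\in K_+$; (3) $k_1\ast k_2\in K_+$ for all $k_1,k_2\in K_+$.
   Formalization: The formal theorem also assumes that the line ℓ has a third point besides O and I; this excludes only the affine plane of order 2, where all betweenness is empty, K₊ = {I} and I + I = O is not in K₊, so the claim fails. *)

(* Defs.v *)
(* MathComp world, with the classical sets of MathComp-Analysis. *)
From mathcomp Require Import all_boot.
From mathcomp Require Import boolp classical_sets.

Set Implicit Arguments.
Unset Strict Implicit.
Unset Printing Implicit Defensive.

Local Open Scope classical_set_scope.

(* [P] is the set of points and [L] the set of lines.  Constructions of lines
   and points are definite descriptions written with [get], which returns an
   arbitrary element of a nonempty set; the instance [P : pointedType] only
   supplies the irrelevant value of [get] on the empty set. *)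

Definition parallel (P : Type) (l m : set P) : Prop :=
  l = m \/ l `&` m = set0.

Definition line_through (P : pointedType) (L : set (set P)) (A B : P) : set P :=
  get [set l | [/\ L l, l A & l B]].

Definition parallel_through (P : pointedType) (L : set (set P))
    (A : P) (l : set P) : set P :=
  get [set m | [/\ L m, m A & parallel m l]].

Definition meet_point (P : pointedType) (l m : set P) : P := get (l `&` m).

Record affine_plane (P : Type) (L : set (set P)) : Prop := AffinePlane {
  ap_line : forall A B : P, A <> B -> exists! l, [/\ L l, l A & l B] ;
  ap_parallel : forall (l : set P) (A : P), L l -> ~ l A ->
    exists! m, [/\ L m, m A & m `&` l = set0] ;
  ap_noncollinear : exists A B C : P,
    [/\ A <> B, B <> C, A <> C & ~ exists l, [/\ L l, l A, l B & l C]]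
}.

Definition desargues_axiom (P : pointedType) (L : set (set P)) : Prop :=
  forall (k l m : set P) (A A' B B' C C' : P),
    L k -> L l -> L m -> k <> l -> l <> m -> k <> m ->
    k A -> k A' -> l B -> l B' -> m C -> m C' ->
    [/\ parallel k l, parallel l m & parallel k m] \/
    (exists S : P, [/\ k S, l S, m S &
       [/\ A <> S /\ A' <> S, B <> S /\ B' <> S & C <> S /\ C' <> S]]) ->
    parallel (line_through L A B) (line_through L A' B') ->
    parallel (line_through L B C) (line_through L B' C') ->
    parallel (line_through L A C) (line_through L A' C').

Definition desargues_affine_plane (P : pointedType) (L : set (set P)) : Prop :=
  affine_plane L /\ desargues_axiom L.

(* [btw A B C] : B lies between A and C. *)
Record ordered_line (P : Type) (l : set P) (btw : P -> P -> P -> Prop) : Prop :=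
  OrderedLine {
  ol_distinct : forall A B C, btw A B C ->
    [/\ l A, l B & l C] /\ [/\ A <> B, B <> C & A <> C] ;
  ol_sym : forall A B C, btw A B C -> btw C B A ;
  ol_trichotomy : forall A B C, l A -> l B -> l C ->
    A <> B -> B <> C -> A <> C ->
    [\/ btw A B C, btw B C A | btw C A B] /\
    [/\ ~ (btw A B C /\ btw B C A), ~ (btw B C A /\ btw C A B)
      & ~ (btw A B C /\ btw C A B)] ;
  ol_trans : forall A B C D, l A -> l B -> l C -> l D ->
    A <> B -> A <> C -> A <> D -> B <> C -> B <> D -> C <> D ->
    btw A B C -> btw B C D -> btw A B D /\ btw A C D ;
  ol_branch : forall A B C D, l A -> l B -> l C -> l D ->
    A <> B -> A <> C -> A <> D -> B <> C -> B <> D -> C <> D ->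
    btw A B C -> btw C B D -> btw D A B \/ btw A D B
}.

(* Projection onto [l2] in the direction of [d]. *)
Definition parallel_projection (P : pointedType) (L : set (set P))
    (d l2 : set P) (A : P) : P :=
  meet_point l2 (parallel_through L A d).

(* Each line [l] carries its own betweenness relation [btw l]. *)
Definition ordered_desargues_affine_plane (P : pointedType) (L : set (set P))
    (btw : set P -> P -> P -> P -> Prop) : Prop :=
  [/\ desargues_affine_plane L,
      forall l, L l -> ordered_line l (btw l)
    & forall l1 l2 d, L l1 -> L l2 -> L d ->
        ~ parallel d l1 -> ~ parallel d l2 ->
        let p := parallel_projection L d l2 in
        forall A B C, btw l1 A B C ->
          btw l2 (p A) (p B) (p C) \/ btw l2 (p C) (p B) (p A)].

(* The sum and product of [A] and [C] computed with the auxiliary point [B]. *)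
Definition sum_via (P : pointedType) (L : set (set P)) (l : set P)
    (O B A C : P) : P :=
  let D := meet_point (parallel_through L B l)
                      (parallel_through L A (line_through L O B)) in
  meet_point l (parallel_through L D (line_through L C B)).

Definition prod_via (P : pointedType) (L : set (set P)) (l : set P)
    (O I B A C : P) : P :=
  let E := meet_point (parallel_through L A (line_through L I B))
                      (line_through L O B) in
  meet_point l (parallel_through L E (line_through L B C)).

(* The auxiliary point may be any point off [l]. *)
Definition line_add (P : pointedType) (L : set (set P)) (l : set P)
    (O A C : P) : P :=
  get [set X | exists2 B, ~ l B & X = sum_via L l O B A C].

Definition line_mul (P : pointedType) (L : set (set P)) (l : set P)
    (O I A C : P) : P :=
  get [set X | exists2 B, ~ l B & X = prod_via L l O I B A C].

Definition positive_points (P : Type) (l : set P)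
    (btw : P -> P -> P -> Prop) (O I : P) : set P :=
  [set I] `|` [set X | l X /\ (btw O X I \/ btw O I X)].

Definition negative_points (P : Type) (l : set P)
    (btw : P -> P -> P -> Prop) (O I : P) : set P :=
  [set X | l X /\ btw X O I].

(* The carrier is a set [K] in an ambient type [T]: the operations are total on
   [T], but only their restrictions to [K] matter. *)
Record skew_field (T : Type) (K : set T) (zero one : T)
    (add mul : T -> T -> T) : Prop := SkewField {
  sf_zero : K zero ;
  sf_one : K one ;
  sf_add : forall x y, K x -> K y -> K (add x y) ;
  sf_mul : forall x y, K x -> K y -> K (mul x y) ;
  sf_addA : forall x y z, K x -> K y -> K z ->
    add x (add y z) = add (add x y) z ;
  sf_addC : forall x y, K x -> K y -> add x y = add y x ;
  sf_add0 : forall x, K x -> add zero x = x ;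
  sf_opp : forall x, K x -> exists2 y, K y & add x y = zero ;
  sf_mulA : forall x y z, K x -> K y -> K z ->
    mul x (mul y z) = mul (mul x y) z ;
  sf_mul1 : forall x, K x -> mul one x = x /\ mul x one = x ;
  sf_mulDl : forall x y z, K x -> K y -> K z ->
    mul (add x y) z = add (mul x z) (mul y z) ;
  sf_mulDr : forall x y z, K x -> K y -> K z ->
    mul x (add y z) = add (mul x y) (mul x z) ;
  sf_nontrivial : one <> zero ;
  sf_inv : forall x, K x -> x <> zero ->
    exists2 y, K y & mul x y = one /\ mul y x = one
}.

Record ordered_skew_field (T : Type) (K : set T) (zero one : T)
    (add mul : T -> T -> T) (Kpos Kneg : set T) : Prop := OrderedSkewField {
  osf_skew_field : skew_field K zero one add mul ;
  osf_cover : K = Kneg `|` [set zero] `|` Kpos ;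
  osf_disjoint : [/\ Kneg `&` [set zero] = set0, [set zero] `&` Kpos = set0
                   & Kneg `&` Kpos = set0] ;
  osf_add : forall x y, Kpos x -> Kpos y -> Kpos (add x y) ;
  osf_mul : forall x y, Kpos x -> Kpos y -> Kpos (mul x y)
}.

(* Main.v *)
Require Import Defs.
From mathcomp Require Import all_boot.
From mathcomp Require Import boolp classical_sets.

(** The two constructions on the line [l] evaluate maps of the whole plane. A
    dilatation is a map [f] such that the vector from [f X] to [f Y] is always
    parallel to the vector [XY]; constant maps are included. Two values
    determine a dilatation ([dilatation_ext]), and Desargues' axiom says that
    enough of them exist: every pencil, concurrent or parallel, carries a
    dilatation that preserves its lines and moves a point [A] to a given point
    [A'] of the same line ([pencil_dilatation]). Parallel pencils give the
    translations and concurrent ones the homotheties.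

    The sum [A + C] is the image of [C] under the translation that takes [O] to
    [A] ([line_addE]), and the product [A * C] is the image of [C] under the
    dilatation that fixes [O] and takes [I] to [A] ([line_mulE]). The auxiliary
    point of the constructions has thereby disappeared, and the axioms of a skew
    field become statements about maps, each proved by comparing two
    dilatations at two points, or two translations at one. Associativity of
    either operation is composition of maps; [A * (C + D) = A * C + A * D] says
    that a dilatation fixing [O] is additive ([dilatation_vadd]), and
    [(A + B) * C = A * C + B * C] that a pointwise sum of such dilatations is
    again one ([dilatation_sum]).

    For a fixed right argument [C], sum and product are each a composition of
    two parallel projections ([sum_via_btw], [prod_via_btw]); hence the maps
    sending [X] to [X + C] and to [X * C], the latter for [C] other than [O],
    preserve betweenness. The rest takes place on the line
    ([ordered_skew_field_of_btw]). The positive points are the points on the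
    same side of zero as one, and being on the same side is transitive
    ([same_side_trans]). Right multiplication by [y] takes one to [y] and
    preserves sides of zero, so products of positive points are positive. For
    sums one needs that zero lies between [-x] and [x] ([opposite_sides]): if
    zero were between [x + y] and [x], translation by [-x] would put [-x]
    between [y] and zero, and [x], [y] would lie on different sides. Zero can
    lie between [-x] and [x] only in characteristic other than two
    ([double_neq0]); this is where a third point on the line enters the order,
    besides providing the points needed to construct the dilatations. *)

Set Implicit Arguments.
Unset Strict Implicit.
Unset Printing Implicit Defensive.

Local Open Scope classical_set_scope.

(** * Parallelism in an affine plane *)

Section AffinePlane.
Context (P : pointedType) (L : set (set P)) (ap : affine_plane L).
Implicit Types (A B C D X Y Z : P) (k l m n : set P).

Lemma parallel_refl l : parallel l l.
Proof. by left. Qed.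

Lemma parallel_sym l m : parallel l m -> parallel m l.
Proof. by case=> [->|h]; [left|right; rewrite setIC]. Qed.

Lemma nparallel_meet l m : ~ parallel l m -> exists X, l X /\ m X.
Proof.
move=> h; apply: contrapT => h2; apply: h; right; apply/seteqP; split=> X //=.
by move=> -[lX mX]; apply: h2; exists X.
Qed.

Lemma parallel_eq l m X : parallel l m -> l X -> m X -> l = m.
Proof.
by case=> // h lX mX; have : (l `&` m) X by []; rewrite h.
Qed.

Lemma line_eq l m A B :
  A <> B -> L l -> L m -> l A -> l B -> m A -> m B -> l = m.
Proof.
move=> nAB Ll Lm lA lB mA mB; have [k [_ ku]] := ap_line ap nAB.
by rewrite -(ku l) // -(ku m).
Qed.

Lemma meet_eq l m X Y : L l -> L m -> l <> m ->
  l X -> m X -> l Y -> m Y -> X = Y.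
Proof.
move=> Ll Lm nlm lX mX lY mY; apply: contrapT => nXY; apply: nlm.
exact: (line_eq nXY).
Qed.

Lemma exists_neq A : exists B, B <> A.
Proof.
have [X [Y [Z [nXY _ _ _]]]] := ap_noncollinear ap.
by have [<-|] := EM (X = A); [exists Y => /esym|exists X].
Qed.

Lemma line_ex A B : exists l, [/\ L l, l A & l B].
Proof.
have [<-|nAB] := EM (A = B); last by have [l [h _]] := ap_line ap nAB; exists l.
have [C nCA] := exists_neq A.
by have [l [[Ll _ lA] _]] := ap_line ap nCA; exists l.
Qed.

Lemma parallel_ex l A : L l -> exists m, [/\ L m, m A & parallel m l].
Proof.
move=> Ll; have [lA|nlA] := EM (l A); first by exists l; split=> //; left.
have [m [[Lm mA ml] _]] := ap_parallel ap Ll nlA; exists m; split=> //.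
by right.
Qed.

Lemma parallel_eq_of l m n A : L l -> L m -> L n ->
  parallel m l -> parallel n l -> m A -> n A -> m = n.
Proof.
move=> Ll Lm Ln pm pn mA nA; have [lA|nlA] := EM (l A).
  by rewrite (parallel_eq pm mA lA) (parallel_eq pn nA lA).
have [k [_ ku]] := ap_parallel ap Ll nlA.
have uniq r : L r -> parallel r l -> r A -> k = r.
  by move=> Lr [e|e] rA; [rewrite e in rA|apply: ku].
by rewrite -(uniq m) // -(uniq n).
Qed.

Lemma parallel_trans m l n : L l -> L m -> L n ->
  parallel l m -> parallel m n -> parallel l n.
Proof.
move=> Ll Lm Ln lm mn; apply: contrapT => nln.
have [X [lX nX]] := nparallel_meet nln; apply: nln; left.
exact: (parallel_eq_of Lm Ll Ln lm (parallel_sym mn) lX nX).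
Qed.

(** The axioms do not say directly that a line has two points. If [s] had at
    most the point [X], a line [n] missing [X] and carrying two points [Y], [Z]
    would be parallel to [s]; so would the parallel to the line [XY] through
    [Z], and these two lines through [Z] differ. *)
Lemma line_other_point s X : L s -> exists2 Y, s Y & Y <> X.
Proof.
move=> Ls; apply: contrapT => hs.
have sX Y : s Y -> Y = X.
  by move=> sY; apply: contrapT => nYX; apply: hs; exists Y.
have [n [Y [Z [nYZ Ln nY nZ nnX]]]] :
    exists n Y Z, [/\ Y <> Z, L n, n Y, n Z & ~ n X].
  apply: contrapT => hn.
  have thruX A B : A <> B -> exists n, [/\ L n, n A, n B & n X].
    move=> nAB; have [n [Ln nA nB]] := line_ex A B; exists n; split=> //.
    by apply: contrapT => nX; apply: hn; exists n, A, B.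
  have [A [B [C [nAB nBC nAC nABC]]]] := ap_noncollinear ap.
  have [a [La aA aB aX]] := thruX _ _ nAB.
  have [b [Lb bB bC bX]] := thruX _ _ nBC.
  have [c [Lc cA cC cX]] := thruX _ _ nAC.
  have [eX|nXB] := EM (X = B).
    by apply: nABC; exists c; split=> //; rewrite -eX.
  apply: nABC; exists a; split=> //.
  by rewrite (line_eq nXB La Lb).
have [k [Lk kX kY]] := line_ex X Y.
have nkZ : ~ k Z by move=> kZ; apply: nnX; rewrite (line_eq nYZ Ln Lk).
have [m [Lm mZ mk]] := parallel_ex Z Lk.
have nsZ : ~ s Z by move/sX => eZ; apply: nnX; rewrite -eZ.
have miss (r : set P) : ~ r X -> r `&` s = set0.
  move=> nrX; apply/seteqP; split=> W //= -[rW /sX eW].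
  by apply: nrX; rewrite -eW.
have nmk W : m W -> k W -> False.
  by move=> mW kW; apply: nkZ; rewrite -(parallel_eq mk mW kW).
have [q [_ qu]] := ap_parallel ap Ls nsZ.
have emn : m = n.
  have <- : q = m by apply: qu; split=> //; apply: miss => mX; exact: (nmk X).
  by apply: qu; split=> //; exact: miss.
by apply: (nmk Y) => //; rewrite emn.
Qed.

Lemma point_off_line l : L l -> exists A, ~ l A.
Proof.
move=> Ll; apply: contrapT => h.
have [A [B [C [_ _ _ nABC]]]] := ap_noncollinear ap; apply: nABC; exists l.
by split=> //; apply: contrapT => nl; apply: h; eexists; exact: nl.
Qed.

(** Parallelism of the vectors [AB] and [CD]. A zero vector is parallel to every
    vector, which makes constant maps dilatations and spares case
    distinctions. *)
Definition par A B C D : Prop :=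
  exists m n, [/\ L m, L n, parallel m n, m A /\ m B & n C /\ n D].

Lemma par_sym A B C D : par A B C D -> par C D A B.
Proof.
move=> [m [n [Lm Ln mn h1 h2]]]; exists n, m.
by split=> //; apply: parallel_sym.
Qed.

Lemma par_flipl A B C D : par A B C D -> par B A C D.
Proof. by move=> [m [n [Lm Ln mn [mA mB] h2]]]; exists m, n. Qed.

Lemma par_flipr A B C D : par A B C D -> par A B D C.
Proof. by move=> /par_sym /par_flipl /par_sym. Qed.

Lemma par0l A C D : par A A C D.
Proof.
have [n [Ln nC nD]] := line_ex C D; have [m [Lm mA mn]] := parallel_ex A Ln.
by exists m, n.
Qed.

Lemma par0r A B C : par A B C C.
Proof. exact/par_sym/par0l. Qed.

Lemma par_refl A B : par A B A B.
Proof.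
by have [n [Ln nC nD]] := line_ex A B; exists n, n; split=> //; left.
Qed.

Lemma par_mem m n A B C D : L m -> L n -> parallel m n -> m A -> m B ->
  n C -> n D -> par A B C D.
Proof. by move=> *; exists m, n. Qed.

Lemma par_line l A B C D : L l -> l A -> l B -> l C -> l D -> par A B C D.
Proof. by move=> Ll *; apply: (par_mem Ll Ll) => //; left. Qed.

Lemma mem_par m n A B C D : A <> B -> L m -> m A -> m B -> par A B C D ->
  L n -> parallel m n -> n C -> n D.
Proof.
move=> nAB Lm mA mB [m' [n' [Lm' Ln' pmn' [mA' mB'] [nC' nD']]]] Ln pmn nC.
have e := line_eq nAB Lm Lm' mA mB mA' mB'; subst m'.
by rewrite (parallel_eq_of Lm Ln Ln' _ _ nC nC') //; exact: parallel_sym.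
Qed.

Lemma mem_col l A B C : A <> B -> L l -> l A -> l B -> par A B A C -> l C.
Proof.
by move=> nAB Ll lA lB h; apply: (mem_par nAB Ll lA lB h Ll) => //; left.
Qed.

Lemma parallel_of_par m n A B C D : A <> B -> C <> D -> L m -> L n ->
  m A -> m B -> n C -> n D -> par A B C D -> parallel m n.
Proof.
move=> nAB nCD Lm Ln mA mB nC nD [m' [n' [Lm' Ln' pmn' [mA' mB'] [nC' nD']]]].
by rewrite (line_eq nAB Lm Lm') // (line_eq nCD Ln Ln').
Qed.

Lemma par_trans C D A B E F :
  C <> D -> par A B C D -> par C D E F -> par A B E F.
Proof.
move=> nCD [m [n [Lm Ln mn [mA mB] [nC nD]]]].
move=> [m' [n' [Lm' Ln' mn' [mC mD] [nE nF]]]].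
have e := line_eq nCD Ln Lm' nC nD mC mD; subst m'.
by apply: (par_mem Lm Ln') => //; apply: (parallel_trans _ Ln).
Qed.

Lemma par_chain A B C D E :
  A <> B -> par A B C D -> par A B D E -> par A B C E.
Proof.
move=> nAB; move=> [m [n [Lm Ln mn [mA mB] [nC nD]]]] h.
by apply: (par_mem Lm Ln) => //; apply: (mem_par nAB Lm mA mB h).
Qed.

(** Lines of different directions meet in at most one point. *)
Lemma par_cancel A B C D X Y :
  ~ par A B C D -> par A B X Y -> par C D X Y -> X = Y.
Proof.
move=> h h1 h2; apply: contrapT => nXY; apply: h.
exact: (par_trans nXY h1 (par_sym h2)).
Qed.

Lemma par_meet A B C D X Y :
  ~ par A B C D -> exists Z, par A B X Z /\ par C D Y Z.
Proof.
move=> h.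
have [m [Lm mA mB]] := line_ex A B; have [n [Ln nC nD]] := line_ex C D.
have [m' [Lm' mX pm]] := parallel_ex X Lm.
have [n' [Ln' nY pn]] := parallel_ex Y Ln.
have [Z [mZ nZ]] : exists Z, m' Z /\ n' Z.
  apply: nparallel_meet => pmn; apply: h; apply: (par_mem Lm Ln) => //.
  apply: (parallel_trans _ Lm' _ (parallel_sym pm)) => //.
  exact: (parallel_trans _ Ln').
by exists Z; split; [apply: (par_mem Lm Lm')|apply: (par_mem Ln Ln')] => //;
  apply: parallel_sym.
Qed.

Lemma npar_neql A B C D : ~ par A B C D -> A <> B.
Proof. by move=> + e; rewrite e => /(_ (par0l _ _ _)). Qed.

Lemma npar_neqr A B C D : ~ par A B C D -> C <> D.
Proof. by move=> + e; rewrite e => /(_ (par0r _ _ _)). Qed.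

Lemma col_swap A B C : par A B A C -> par B A B C.
Proof.
have [<-|nAB] := EM (A = B) => h; first exact: par0l.
exact/par_flipl/(par_chain nAB _ h)/par_flipr/par_refl.
Qed.

Lemma npar_point A B : A <> B -> exists C, ~ par A B A C.
Proof.
move=> nAB; have [l [Ll lA lB]] := line_ex A B.
have [C nlC] := point_off_line Ll; exists C => h; apply: nlC.
exact: (mem_col nAB Ll lA lB h).
Qed.

(** Two of three points [A], [B], [C] of [l] lie on the same one of two lines
    covering the plane, so [l] is one of them. If the other one, [k], meets
    [l], then the parallel to [k] through a point [p] of [l] off [k] has no room
    for a second point. If [k] is parallel to [l], a line joining a point of
    [l] and a point of [k] consists of these two points; for distinct [y], [b]
    on [k], the lines [yA] and [yC] are then two parallels to [bB] through
    [y]. *)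
Lemma point_off_two_lines l A B C : L l -> l A -> l B -> l C ->
  A <> B -> C <> A -> C <> B ->
  forall m n, L m -> L n -> exists Z, ~ m Z /\ ~ n Z.
Proof.
move=> Ll lA lB lC nAB nCA nCB m n Lm Ln; apply: contrapT => hmn.
have no_cover k : L k -> ~ (forall Z, l Z \/ k Z).
  move=> Lk cov; have [b nlb] := point_off_line Ll.
  have kb : k b by case: (cov b).
  have nlk : l <> k by move=> e; rewrite e in nlb.
  have [plk|nplk] := EM (parallel l k).
    have dis z : l z -> k z -> False.
      by move=> lz kz; apply: nlk; exact: (parallel_eq plk lz kz).
    have two r p q : L r -> r p -> r q -> l p -> k q ->
        forall z, r z -> z = p \/ z = q.
      move=> Lr rp rq lp kq z rz; case: (cov z) => hz; [left|right].
        by apply: (@meet_eq r l) => // e; apply: (dis q) => //; rewrite -e.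
      by apply: (@meet_eq r k) => // e; apply: (dis p) => //; rewrite -e.
    have [y ky nyb] := line_other_point b Lk.
    have [a [La ay aA]] := line_ex y A.
    have [c [Lc cy cC]] := line_ex y C.
    have [r [Lr rb rB]] := line_ex b B.
    have pr q p : L q -> q y -> q p -> l p -> p <> B -> parallel q r.
      move=> Lq qy qp lp npB; right; apply/seteqP; split=> z //= -[qz rz].
      have := two q p y Lq qp qy lp ky z qz.
      have := two r B b Lr rB rb lB kb z rz.
      move=> [->|->] [] // h; first exact: npB.
      - by apply: (dis B) => //; rewrite h.
      - by apply: nlb; rewrite h.
      - by apply: nyb.
    have e : a = c.
      by apply: (parallel_eq_of Lr _ _ _ _ ay cy) => //;
        [apply: (pr a A)|apply: (pr c C)].
    apply: (dis y) => //; rewrite -e in cC.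
    by rewrite -(line_eq nCA La Ll cC aA lC lA).
  have [s [ls ks]] := nparallel_meet nplk.
  have [p lp nps] := line_other_point s Ll.
  have nkp : ~ k p by move=> kp; apply: nps; exact: (meet_eq Ll Lk).
  have [r [Lr rp rk]] := parallel_ex p Lk.
  have [q rq nqp] := line_other_point p Lr.
  case: (cov q) => hq.
    have e := line_eq nqp Lr Ll rq rp hq lp; subst r.
    exact: nplk.
  by apply: nkp; rewrite -(parallel_eq rk rq hq).
have cov Z : m Z \/ n Z.
  apply: contrapT => h; apply: hmn; exists Z.
  by split=> hZ; apply: h; [left|right].
have nm : m <> l by move=> e; subst m; exact: (no_cover n).
have nn : n <> l.
  move=> e; subst n; apply: (no_cover m) => // Z.
  by case: (cov Z); [right|left].
have pig r X Y : L r -> r <> l -> X <> Y -> l X -> l Y -> r X -> r Y -> False.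
  by move=> Lr nr nXY lX lY rX rY; apply: nr; exact: (line_eq nXY).
have [mA|nA] := cov A; have [mB|nB] := cov B; have [mC|nC] := cov C.
- exact: (pig m A B).
- exact: (pig m A B).
- exact: (pig m C A).
- exact: (pig n C B).
- exact: (pig m C B).
- exact: (pig n C A).
- exact: (pig n A B).
- exact: (pig n A B).
Qed.

(** * Pencils and their dilatations *)

Lemma line_throughE l A B : A <> B -> L l -> l A -> l B ->
  line_through L A B = l.
Proof.
move=> nAB Ll lA lB; apply: get_unique => // m [Lm mA mB].
exact: (line_eq nAB).
Qed.

Lemma par_on k A B Y Z : Y <> Z -> L k -> k Y -> k Z -> k B ->
  par A B Y Z -> k A.
Proof.
move=> nYZ Lk kY kZ kB /par_sym /par_flipr h.
by apply: (mem_par nYZ Lk kY kZ h Lk _ kB); left.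
Qed.

Context (desargues : desargues_axiom L).
Context (off_two : forall m n, L m -> L n -> exists Z, ~ m Z /\ ~ n Z).

(** The lines through a point and the lines of one direction, treated alike:
    [ctr] is the set of common points of the lines, a single point or empty. *)
Record pencil (c : set (set P)) (ctr : set P) : Prop := Pencil {
  pencil_line : forall m, c m -> L m ;
  pencil_ctr : forall m Z, c m -> ctr Z -> m Z ;
  pencil_ex : forall X, exists2 m, c m & m X ;
  pencil_eq : forall m n X, c m -> c n -> ~ ctr X -> m X -> n X -> m = n ;
  pencil_desargues : forall k l m A A' B B' C C', c k -> c l -> c m ->
    k <> l -> l <> m -> k <> m -> k A -> k A' -> l B -> l B' -> m C -> m C' ->
    [/\ ~ ctr A, ~ ctr B & ~ ctr C] -> [/\ ~ ctr A', ~ ctr B' & ~ ctr C'] ->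
    parallel (line_through L A B) (line_through L A' B') ->
    parallel (line_through L B C) (line_through L B' C') ->
    parallel (line_through L A C) (line_through L A' C')
}.

Lemma concurrent_pencil S : pencil [set m | L m /\ m S] [set S].
Proof.
split=> //=.
- by move=> m [].
- by move=> m Z [_ mS] ->.
- by move=> X; have [m [Lm mX mS]] := line_ex X S; exists m.
- by move=> m n X [Lm mS] [Ln nS] nXS mX nX; exact: (line_eq nXS).
move=> k l m A A' B B' C C' [Lk kS] [Ll lS] [Lm mS] nkl nlm nkm.
move=> kA kA' lB lB' mC mC' [nA nB nC] [nA' nB' nC'].
apply: (@desargues k l m) => //; right; exists S; split=> //.
Qed.

Lemma parallel_pencil d : L d -> pencil [set m | L m /\ parallel m d] set0.
Proof.
move=> Ld; split=> //=.
- by move=> m [].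
- by move=> X; have [m [Lm mX md]] := parallel_ex X Ld; exists m.
- move=> m n X [Lm md] [Ln nd] _ mX nX.
  exact: (parallel_eq_of Ld Lm Ln md nd mX nX).
move=> k l m A A' B B' C C' [Lk kd] [Ll ld] [Lm md] nkl nlm nkm.
move=> kA kA' lB lB' mC mC' _ _; apply: (@desargues k l m) => //; left.
have tr p q : L p -> L q -> parallel p d -> parallel q d -> parallel p q.
  by move=> Lp Lq pd /parallel_sym; exact: parallel_trans.
by split; exact: tr.
Qed.

(** Desargues' axiom for [par]; the lines [k] and [m] may coincide because all
    vectors on one line are parallel. *)
Lemma pencil_par c ctr k l m A A' B B' C C' : pencil c ctr ->
  c k -> c l -> c m -> k <> l -> l <> m ->
  k A -> k A' -> l B -> l B' -> m C -> m C' ->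
  [/\ ~ ctr A, ~ ctr B & ~ ctr C] -> [/\ ~ ctr A', ~ ctr B' & ~ ctr C'] ->
  par A B A' B' -> par B C B' C' -> par A C A' C'.
Proof.
move=> pc ck cl cm nkl nlm kA kA' lB lB' mC mC' nc nc' pAB pBC.
have Lc := pencil_line pc.
have [ekm|nkm] := EM (k = m).
  by subst m; apply: (par_line (Lc _ ck)).
have neq p q X Y : c p -> c q -> p <> q -> p X -> q Y -> ~ ctr X -> X <> Y.
  move=> cp cq npq pX qY nX e; subst Y; apply: npq.
  exact: (pencil_eq pc cp cq nX).
have [nA nB nC] := nc; have [nA' nB' nC'] := nc'.
have through X Y : X <> Y -> [/\ L (line_through L X Y), line_through L X Y X
    & line_through L X Y Y].
  move=> nXY; have [r [Lr rX rY]] := line_ex X Y.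
  by rewrite (line_throughE nXY Lr rX rY).
have toline X Y X' Y' : X <> Y -> X' <> Y' -> par X Y X' Y' ->
    parallel (line_through L X Y) (line_through L X' Y').
  move=> n1 n2 pXY; have [? ? ?] := through _ _ n1.
  have [? ? ?] := through _ _ n2.
  exact: (parallel_of_par n1 n2).
have nAC := neq k m A C ck cm nkm kA mC nA.
have nAC' := neq k m A' C' ck cm nkm kA' mC' nA'.
have [? ? ?] := through _ _ nAC; have [? ? ?] := through _ _ nAC'.
suff h : parallel (line_through L A C) (line_through L A' C').
  exact: (par_mem _ _ h).
apply: (pencil_desargues pc ck cl cm nkl nlm nkm kA kA' lB lB' mC mC' nc nc').
  by apply: toline => //; [apply: (neq k l)|apply: (neq k l)].
by apply: toline => //; [apply: (neq l m)|apply: (neq l m)].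
Qed.

Definition dilatation (f : P -> P) : Prop := forall X Y, par X Y (f X) (f Y).

(** The image [Y] of [X] that is forced on a dilatation preserving the lines of
    the pencil and taking [A] to [A']. *)
Lemma pencil_image c ctr m k A A' X : pencil c ctr -> c m -> c k -> k <> m ->
  m A -> m A' -> k X -> ~ ctr A -> ~ ctr A' -> ~ ctr X ->
  exists Y, [/\ k Y, ~ ctr Y & par A X A' Y].
Proof.
move=> pc cm ck nkm mA mA' kX nA nA' nX.
have [Lm Lk] : L m /\ L k by split; apply: (pencil_line pc).
have nmX : ~ m X by move=> mX; apply: nkm; exact: (pencil_eq pc ck cm nX).
have nAX : A <> X by move=> e; subst X.
have [n [Ln nA1 nX1]] := line_ex A X.
have [n' [Ln' n'A' pn]] := parallel_ex A' Ln.
have [Y [kY nY]] : exists Y, k Y /\ n' Y.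
  apply: nparallel_meet => pk; apply: nkm.
  have pkn : parallel k n by apply: (parallel_trans _ Ln').
  have e := parallel_eq pkn kX nX1; subst n.
  exact: (pencil_eq pc ck cm nA).
exists Y; split=> //; last first.
  by apply: (par_mem Ln Ln') => //; exact: parallel_sym.
move=> cY; have mY := pencil_ctr pc cm cY.
have nA'Y : A' <> Y by move=> e; subst Y.
have e := line_eq nA'Y Ln' Lm n'A' nY mA' mY; subst n'.
by apply: nmX; rewrite (parallel_eq pn mA nA1).
Qed.

(** Off the line [m] the image of [X] is found on the line of the pencil
    through [X] by comparison with [A] and [A']; on [m] a second pair [B],
    [B'] off [m] takes over the part of [A], [A']. Desargues' axiom makes all
    these choices compatible. *)
Theorem pencil_dilatation c ctr m A A' : pencil c ctr -> c m -> m A -> m A' ->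
  ~ ctr A -> ~ ctr A' ->
  exists f, [/\ dilatation f, f A = A' & forall k X, c k -> k X -> k (f X)].
Proof.
move=> pc cm mA mA' nA nA'.
have Lc := pencil_line pc.
have off k k' : c k -> c k' -> exists Z, [/\ ~ ctr Z, ~ k Z & ~ k' Z].
  move=> ck ck'; have [Z [h1 h2]] := off_two (Lc _ ck) (Lc _ ck').
  by exists Z; split=> // /(pencil_ctr pc ck).
have [B [nB nmB _]] := off m m cm cm.
have [b cb bB] := pencil_ex pc B.
have nbm : b <> m by move=> e; subst b.
have [B' [bB' nB' pB]] := pencil_image pc cm cb nbm mA mA' bB nA nA' nB.
pose image X Y := [/\ ctr X -> Y = X, forall k, c k -> k X -> k Y,
  ~ ctr X -> ~ ctr Y, ~ m X -> par A X A' Y & ~ ctr X -> m X -> par B X B' Y].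
have [f hf] : {f : P -> P & forall X, image X (f X)}.
  apply: (@choice _ _ image) => X; have [cX|nX] := EM (ctr X).
    by exists X; split=> // nmX; case: nmX; exact: (pencil_ctr pc).
  have [k ck kX] := pencil_ex pc X.
  have on Y : k Y -> forall k, c k -> k X -> k Y.
    by move=> kY k' ck' kX'; rewrite (pencil_eq pc ck' ck nX).
  have [mX|nmX] := EM (m X).
    have e := pencil_eq pc ck cm nX kX mX; subst k.
    have nmb : m <> b by move=> e; subst b.
    have [Y [kY nY pY]] := pencil_image pc cb cm nmb bB bB' mX nB nB' nX.
    by exists Y; split=> //; exact: on.
  have nkm : k <> m by move=> e; subst k.
  have [Y [kY nY pY]] := pencil_image pc cm ck nkm mA mA' kX nA nA' nX.
  by exists Y; split=> //; exact: on.
have fctr X : ctr X -> f X = X by case: (hf X).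
have fon k X : c k -> k X -> k (f X) by case: (hf X) => _ + _ _ _; exact.
have fn X : ~ ctr X -> ~ ctr (f X) by case: (hf X).
have foff X : ~ m X -> par A X A' (f X) by case: (hf X).
have fm X : ~ ctr X -> m X -> par B X B' (f X) by case: (hf X).
have nm_eq k X : c k -> k X -> ~ m X -> k <> m by move=> _ kX nmX e; subst k.
have same k X Y : c k -> k X -> k Y -> par X Y (f X) (f Y).
  by move=> ck kX kY; apply: (par_line (Lc _ ck)) => //; exact: fon.
have poff X Y : ~ ctr X -> ~ ctr Y -> ~ m X -> ~ m Y -> par X Y (f X) (f Y).
  move=> nX nY nmX nmY; have [k ck kX] := pencil_ex pc X.
  have [r cr rY] := pencil_ex pc Y.
  have nmr : m <> r by move=> e; subst r.
  have nkm := nm_eq k X ck kX nmX.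
  apply: (pencil_par pc ck cm cr nkm nmr kX _ mA mA' rY) => //.
  - exact: fon.
  - exact: fon.
  - by split=> //; exact: fn.
  - exact/par_flipl/par_flipr/foff.
  - exact: foff.
have fB : f B = B'.
  apply: contrapT => nfB; apply: nbm; apply: (pencil_eq pc cb cm nA _ mA).
  have nAB : A <> B by move=> e; subst B.
  have p := par_chain nAB (par_flipr (foff B nmB)) pB.
  exact: (par_on nfB (Lc _ cb) (fon b B cb bB) bB' bB p).
have via k r z X Y Z : c k -> c r -> c z -> k <> r -> r <> z ->
    k X -> r Y -> z Z -> ~ ctr X -> ~ ctr Y -> ~ ctr Z ->
    par X Y (f X) (f Y) -> par Y Z (f Y) (f Z) -> par X Z (f X) (f Z).
  move=> ck cr cz nkr nrz kX rY zZ nX nY nZ.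
  have [kX' rY' zZ'] := And3 (fon k X ck kX) (fon r Y cr rY) (fon z Z cz zZ).
  apply: (pencil_par pc ck cr cz nkr nrz kX kX' rY rY' zZ zZ') => //.
  by split; exact: fn.
have mix X Y : ~ ctr X -> ~ ctr Y -> m X -> ~ m Y -> par X Y (f X) (f Y).
  move=> nX nY mX nmY; have [k ck kY] := pencil_ex pc Y.
  have nmk : m <> k by move=> e; subst k.
  have nmb : m <> b by move=> e; subst b.
  have pXB : par X B (f X) (f B) by rewrite fB; apply/par_flipl/par_flipr/fm.
  have [ebk|nbk] := EM (b = k); last first.
    by apply: (via m b k X B Y) => //; apply: poff.
  (* [Y] and [B] are on one line of the pencil: use a point of a third one. *)
  subst k; have [Z [nZ nmZ nbZ]] := off m b cm cb.
  have [z cz zZ] := pencil_ex pc Z.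
  have [nmz nbz] : m <> z /\ b <> z by split=> e; subst z.
  apply: (via m z b X Z Y) => //; [exact: nesym nbz|idtac|exact: poff].
  by apply: (via m b z X B Z) => //; exact: poff.
exists f; split=> //; last first.
  apply: contrapT => nfA; apply: (nmB).
  have nBA : B <> A by move=> e; subst B.
  have p := par_chain nBA (par_flipr (fm A nA mA)) (par_flipl (par_flipr pB)).
  exact: (par_on nfA (Lc _ cm) (fon m A cm mA) mA' mA p).
move=> X Y; have [cX|nX] := EM (ctr X).
  have [k ck kY] := pencil_ex pc Y.
  by apply: (same k) => //; exact: (pencil_ctr pc).
have [cY|nY] := EM (ctr Y).
  have [k ck kX] := pencil_ex pc X.
  by apply: (same k) => //; exact: (pencil_ctr pc).
have [mX|nmX] := EM (m X); have [mY|nmY] := EM (m Y).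
- exact: (same m).
- exact: mix.
- by apply/par_flipl/par_flipr; exact: mix.
- exact: poff.
Qed.

(** * Dilatations and translations *)

Lemma par_meet_col A B X : par A X B X -> par A B A X.
Proof. by move=> /par_flipl /par_flipr /col_swap /par_sym. Qed.

Lemma dilatation_id : dilatation id.
Proof. by move=> X Y; exact: par_refl. Qed.

Lemma dilatation_cst A : dilatation (fun=> A).
Proof. by move=> X Y; exact: par0r. Qed.

Lemma dilatation_comp f g : dilatation f -> dilatation g -> dilatation (f \o g).
Proof.
move=> hf hg X Y /=; have [->|ng] := EM (g X = g Y); first exact: par0r.
exact: (par_trans ng (hg X Y) (hf _ _)).
Qed.

(** The image of a point [X] off the line [AB] lies on the parallels to [AX] and
    to [BX] through the images of [A] and [B]. A point on the line [AB] is off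
    the line [AZ], for any [Z] off [AB]. *)
Lemma dilatation_ext f g A B : dilatation f -> dilatation g -> A <> B ->
  f A = g A -> f B = g B -> f = g.
Proof.
move=> df dg nAB eA eB.
have fg C X : f C = g C -> par C X (f X) (g X).
  move=> eC; have [->|nCX] := EM (C = X); first exact: par0l.
  by apply: (par_chain nCX (par_flipr (df C X))); rewrite eC.
have off C D X : f C = g C -> f D = g D -> ~ par C D C X -> f X = g X.
  move=> eC eD nX; apply: (@par_cancel C X D X); [|exact: fg|exact: fg].
  by move=> /par_meet_col.
have [Z nZ] := npar_point nAB; have eZ := off A B Z eA eB nZ.
have nAZ : A <> Z := npar_neqr nZ.
apply/funext => X; have [pX|nX] := EM (par A B A X); last exact: (off A B).
have [<-//|nAX] := EM (A = X).
apply: (off A Z) => // pZ; apply: nZ.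
exact: (par_trans nAX pX (par_sym pZ)).
Qed.

Definition translation (f : P -> P) : Prop :=
  dilatation f /\ forall X Y, par X (f X) Y (f Y).

Lemma translation_id : translation id.
Proof. by split; [exact: dilatation_id|move=> X Y; exact: par0l]. Qed.

(** Every [X] is collinear with [A] and [f X], and all vectors from [X] to
    [f X] are parallel; so only the points of one line through [A] could be
    moved, and a point off this line is a second fixed point. *)
Lemma translation_fix f A : translation f -> f A = A -> f = id.
Proof.
move=> [df tf] fA.
have col X : par A X A (f X) by rewrite -{2}fA.
have [B nBA] := exists_neq A.
have nAB : A <> B by exact/nesym.
have [fB|nfB] := EM (f B = B).
  exact: (dilatation_ext df dilatation_id nAB).
have [C nC] := npar_point nAB; have nAC : A <> C := npar_neqr nC.
have pB : par A B B (f B) by exact/par_flipl/col_swap/col.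
suff fC : f C = C by exact: (dilatation_ext df dilatation_id nAC).
apply: (@par_cancel A B A C) => //.
- by apply/par_flipr; exact: (par_trans (nesym nfB) pB (tf B C)).
- exact/par_flipr/par_flipl/col_swap/col.
Qed.

Lemma translation_ext f g A : translation f -> translation g -> f A = g A ->
  f = g.
Proof.
move=> tf tg eA; have [fA|nfA] := EM (f A = A).
  by rewrite (translation_fix tf fA) (@translation_fix g A) // -eA.
have [[df pf] [dg pg]] := (tf, tg).
have [B nB] := npar_point (nesym nfA).
have nAB : A <> B := npar_neqr nB.
apply: (dilatation_ext df dg nAB) => //; apply: (@par_cancel A B A (f A)).
- by move=> /par_sym.
- by apply: (par_chain nAB (par_flipr (df A B))); rewrite eA.
- apply: (par_chain (nesym nfA) (par_flipr (pf A B))); rewrite eA; exact: pg.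
Qed.

(** A dilatation maps the line through a point and its image into itself. *)
Lemma dilatation_trace f X Z : dilatation f -> X <> f X ->
  par X (f X) X Z -> par X (f X) Z (f Z).
Proof.
move=> df nX pZ; have [<-|nXZ] := EM (X = Z); first exact: par_refl.
apply: (par_trans nXZ pZ).
apply: (par_chain nXZ (par_flipr (par_refl X Z))).
by apply: (par_chain nXZ _ (df X Z)); exact: par_sym.
Qed.

(** Two non-parallel traces [X (f X)] and [Y (f Y)] would meet in a fixed
    point, because [f] maps the line [X (f X)] into itself. *)
Lemma translation_of_nofix f : dilatation f -> (forall X, f X <> X) ->
  translation f.
Proof.
move=> df nf; split=> // X Y; apply: contrapT => np.
have [Z [pX pY]] := par_meet X Y np.
apply: (nf Z); apply/esym; apply: (par_cancel np).
- exact: (dilatation_trace df (nesym (nf X))).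
- exact: (dilatation_trace df (nesym (nf Y))).
Qed.

(** A composition without fixed points is a translation. If [X] is fixed, [f]
    moves [g X] back to [X], and [f] and [g] move points in the same
    direction. *)
Lemma translation_comp f g : translation f -> translation g ->
  translation (f \o g).
Proof.
move=> tf tg; have [[df pf] [dg pg]] := (tf, tg).
have dfg := dilatation_comp df dg.
have [[X fgX]|nfix] := EM (exists X, f (g X) = X); last first.
  by apply: translation_of_nofix => // X e; apply: nfix; exists X.
have [gX|ngX] := EM (g X = X).
  rewrite gX in fgX; rewrite (translation_fix tg gX) (translation_fix tf fgX).
  exact: translation_id.
have h Z : par X (g X) Z (f (g Z)).
  apply: (par_chain (nesym ngX) (pg X Z)).
  by apply/par_flipl; have := pf (g X) (g Z); rewrite fgX.
split=> // Y Z /=.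
exact: (par_trans (nesym ngX) (par_sym (h Y)) (h Z)).
Qed.

Lemma translation_ex A B : exists f, translation f /\ f A = B.
Proof.
have [<-|nAB] := EM (A = B).
  by exists id; split=> //; exact: translation_id.
have [d [Ld dA dB]] := line_ex A B.
have [f [df fA fd]] := pencil_dilatation (parallel_pencil Ld)
  (conj Ld (parallel_refl d)) dA dB id id.
exists f; split=> //; split=> // X Y.
have on Z : par A B Z (f Z).
  have [m [Lm mZ md]] := parallel_ex Z Ld.
  apply: (par_mem Ld Lm (parallel_sym md)) => //.
  exact: (fd m).
exact: (par_trans nAB (par_sym (on X)) (on Y)).
Qed.

Lemma dilatation_ex S A B : S <> A -> par S A S B ->
  exists f, [/\ dilatation f, f S = S & f A = B].
Proof.
move=> nSA pB; have [<-|nSB] := EM (S = B).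
  by exists (fun=> S); split=> //; exact: dilatation_cst.
have [m [Lm mS mA]] := line_ex S A.
have mB := mem_col nSA Lm mS mA pB.
have [f [df fA fm]] := pencil_dilatation (concurrent_pencil S) (conj Lm mS)
  mA mB (nesym nSA) (nesym nSB).
exists f; split=> //; have [C nC] := npar_point nSA.
have nSC := npar_neqr nC.
have [k [Lk kS kC]] := line_ex S C.
apply: contrapT => nfS; apply: nC.
have [mf kf] : m (f S) /\ k (f S) by split; exact: fm.
have e := line_eq (nesym nfS) Lm Lk mS mf kS kf.
by apply: (par_line Lm) => //; rewrite e.
Qed.

(** * The group of vectors *)

Definition vadd O A : P -> P := get [set f | translation f /\ f O = A].

Section Vectors.
Context (O : P).
Local Notation "A +v B" := (vadd O A B) (at level 50, left associativity).

Lemma vaddP A : translation (vadd O A) /\ A +v O = A.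
Proof. exact: (getPex (translation_ex O A)). Qed.

Lemma vadd_tr A : translation (vadd O A). Proof. by case: (vaddP A). Qed.

Lemma vadd_dil A : dilatation (vadd O A). Proof. by case: (vadd_tr A). Qed.

Lemma vaddv0 A : A +v O = A. Proof. by case: (vaddP A). Qed.

Lemma vadd_eq A f : translation f -> f O = A -> vadd O A = f.
Proof.
move=> tf fO; apply: (translation_ext (vadd_tr A) tf (A := O)).
by rewrite vaddv0.
Qed.

Lemma vadd0v A : O +v A = A.
Proof. by rewrite (vadd_eq translation_id). Qed.

(** Both sides are the value at [C] of a translation, and the translations
    agree at [O]. *)
Lemma vaddA A B C : A +v (B +v C) = A +v B +v C.
Proof.
rewrite (@vadd_eq (A +v B) (vadd O A \o vadd O B)) //=; last by rewrite vaddv0.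
by apply: translation_comp; exact: vadd_tr.
Qed.

Lemma vaddIv A B C : A +v C = B +v C -> A = B.
Proof.
move=> e; rewrite -(vaddv0 A) -(vaddv0 B).
by rewrite (translation_ext (vadd_tr A) (vadd_tr B) e).
Qed.

Lemma vadd_par A B C : par A B (C +v A) (C +v B).
Proof. exact: vadd_dil. Qed.

Lemma vadd_par0 A B : par O A B (A +v B).
Proof. by have [_ /(_ O B)] := vadd_tr A; rewrite vaddv0. Qed.

Lemma vadd_parr A B : par O A B (B +v A).
Proof. by rewrite -{1}(vaddv0 B); exact: vadd_par. Qed.

(** For independent [A] and [B] both sums are the fourth vertex of the
    parallelogram on [OA] and [OB]; otherwise an auxiliary vector [C] outside
    the line reduces the claim to that case. *)
Lemma vaddC A B : A +v B = B +v A.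
Proof.
have indep C D : ~ par O C O D -> C +v D = D +v C.
  move=> nCD; have [nC nD] := (npar_neql nCD, npar_neqr nCD).
  apply: (par_cancel nCD).
  - apply: (par_chain nC _ (vadd_parr C D)); exact/par_flipr/vadd_par0.
  - apply: (par_chain nD _ (vadd_par0 D C)); exact/par_flipr/vadd_parr.
have [<-|nA] := EM (O = A); first by rewrite vadd0v vaddv0.
have [<-|nB] := EM (O = B); first by rewrite vadd0v vaddv0.
have [pAB|/indep//] := EM (par O A O B).
have [C nC] := npar_point nA.
have nBC : ~ par O B O C.
  by move=> p; apply: nC; exact: (par_trans nB pAB p).
have nABC : ~ par O A O (B +v C).
  move=> p; apply: nC; apply: (par_chain nA p); apply: par_flipr.
  exact: (par_trans nB pAB (vadd_par0 B C)).
apply: (@vaddIv _ _ C); rewrite -!vaddA (indep _ _ nABC) -vaddA.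
by rewrite -(indep _ _ nC).
Qed.

Lemma vaddvI A B C : C +v A = C +v B -> A = B.
Proof. by rewrite ![C +v _]vaddC; exact: vaddIv. Qed.

Lemma vopp_ex A : exists B, A +v B = O.
Proof.
have [g [tg gA]] := translation_ex A O; exists (g O).
have t := translation_comp (vadd_tr A) tg.
have e : (vadd O A \o g) A = A by rewrite /= gA vaddv0.
by have := f_equal (fun f => f O) (translation_fix t e).
Qed.

Lemma vadd_col A B C : par O A O B -> par O A O C -> par O A O (B +v C).
Proof.
move=> pB pC; have [<-|nA] := EM (O = A); first exact: par0l.
apply: (par_chain nA pB).
have [<-|nC] := EM (O = C); first by rewrite vaddv0; exact: par0r.
exact: (par_trans nC pC (vadd_parr C B)).
Qed.

Lemma vopp_col A B C : par O A O B -> B +v C = O -> par O A O C.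
Proof.
move=> pB e; have [eB|nB] := EM (O = B).
  by move: e; rewrite -eB vadd0v => ->; exact: par0r.
apply: (par_trans nB pB); have := vadd_par0 B C; rewrite e.
by move=> h; apply/par_flipr.
Qed.

(** For independent [A] and [B] the image of their parallelogram is again a
    parallelogram, unless [h] is constant; the dependent case follows as for
    commutativity. *)
Lemma dilatation_vadd h A B : dilatation h -> h O = O ->
  h (A +v B) = h A +v h B.
Proof.
move=> dh hO.
have col C : par O C O (h C) by rewrite -{2}hO.
have cst C D : O <> C -> h C = O -> h D = O.
  move=> nC hC.
  by rewrite (dilatation_ext dh (dilatation_cst O) nC) // hO.
have indep C D : ~ par O C O D -> h (C +v D) = h C +v h D.
  move=> nCD; have [nC nD] := (npar_neql nCD, npar_neqr nCD).
  have zero E : O <> E -> h E = O -> h (C +v D) = h C +v h D.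
    move=> nE hE; have z := fun X => cst E X nE hE.
    by rewrite (z C) (z D) (z (C +v D)) vaddv0.
  have [/(zero C nC)//|hC] := EM (h C = O).
  have [/(zero D nD)//|hD] := EM (h D = O).
  have half E F : O <> E -> O <> F -> h E <> O ->
      par O E (h (F +v E)) (h F +v h E).
    move=> nE nF hE.
    have nFE : F <> F +v E.
      by rewrite -{1}(vaddv0 F) => /vaddvI.
    have p1 : par O E (h F) (h (F +v E)).
      exact: (par_trans nFE (vadd_parr E F) (dh _ _)).
    have p2 := par_trans (nesym hE) (col E) (vadd_parr (h E) (h F)).
    exact: (par_chain nE (par_flipr p1) p2).
  apply: (par_cancel nCD); last exact: half.
  by rewrite (vaddC C) (vaddC (h C)); exact: half.
have [<-|nA] := EM (O = A); first by rewrite hO !vadd0v.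
have [pAB|/indep//] := EM (par O A O B).
have [C nC] := npar_point nA.
have line D : par O A O D -> h (D +v C) = h D +v h C.
  move=> pD; have [<-|nD] := EM (O = D); first by rewrite hO !vadd0v.
  by apply: indep => p; apply: nC; exact: (par_trans nD pD p).
apply: (@vaddIv _ _ (h C)); rewrite -line; last exact/vadd_col/pAB/par_refl.
rewrite -!vaddA -(line B) //; apply: indep => p; apply: nC.
apply: (par_chain nA p); apply: par_flipr.
have [<-|nB] := EM (O = B); first by rewrite vadd0v; exact: par0r.
exact: (par_trans nB pAB (vadd_par0 B C)).
Qed.

(** By additivity, [X +v V] and [X] have images that differ by
    [h V +v g V], which is parallel to [V]. *)
Lemma dilatation_sum h g : dilatation h -> dilatation g -> h O = O -> g O = O ->
  dilatation (fun X => h X +v g X).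
Proof.
move=> dh dg hO gO X Y; have [X' eX] := vopp_ex X.
have -> : Y = X +v (X' +v Y) by rewrite vaddA eX vadd0v.
move: (X' +v Y) => V.
rewrite !(dilatation_vadd _ _ dh) // !(dilatation_vadd _ _ dg) //.
have -> : h X +v h V +v (g X +v g V) = h X +v g X +v (h V +v g V).
  by rewrite -!vaddA (vaddA (h V)) (vaddC (h V)) -vaddA.
have pW : par O V O (h V +v g V).
  by apply: vadd_col; [rewrite -{2}hO|rewrite -{2}gO].
move: (h V +v g V) (h X +v g X) pW => W Z pW.
have [<-|nV] := EM (O = V); first by rewrite vaddv0; exact: par0l.
have [<-|nW] := EM (O = W); first by rewrite vaddv0; exact: par0r.
apply: (par_trans nV (par_sym (vadd_parr V X))).
exact: (par_trans nW pW (vadd_parr W Z)).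
Qed.

End Vectors.

(** * The skew field on a line *)

Lemma parallel_throughE d m A : L d -> L m -> m A -> parallel m d ->
  parallel_through L A d = m.
Proof.
move=> Ld Lm mA md; apply: get_unique => // n [Ln nA nd].
exact: (parallel_eq_of Ld Ln Lm nd md nA mA).
Qed.

Lemma meet_pointE l m X : L l -> L m -> l <> m -> l X -> m X ->
  meet_point l m = X.
Proof.
move=> Ll Lm nlm lX mX; apply: get_unique => // Y [lY mY].
exact: (meet_eq Ll Lm).
Qed.

Lemma dilatation_line f l X Y : dilatation f -> L l -> l X -> l (f X) -> l Y ->
  l (f Y).
Proof.
move=> df Ll lX lfX lY; have [<-//|nXY] := EM (X = Y).
by apply: (mem_par nXY Ll lX lY (df X Y) Ll) => //; left.
Qed.

Section LineOperations.
Context (l : set P) (Ll : L l) (O I : P) (lO : l O) (lI : l I) (nOI : O <> I).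
Local Notation "A +v B" := (vadd O A B) (at level 50, left associativity).

(** The common last step of both constructions: the image of [C] under a
    dilatation is found on [l] from the image of [B]. *)
Lemma last_projection f B C : dilatation f -> ~ l B -> l C -> l (f C) ->
  meet_point l (parallel_through L (f B) (line_through L C B)) = f C.
Proof.
move=> df nlB lC lfC; have nCB : C <> B by move=> e; subst B.
have [c [Lc cC cB]] := line_ex C B; rewrite (line_throughE nCB Lc cC cB).
have [e [Le eB ec]] := parallel_ex (f B) Lc.
rewrite (parallel_throughE Lc Le eB ec); apply: meet_pointE => //.
  move=> ele; subst e; apply: nlB.
  by rewrite (parallel_eq ec lC cC).
apply: (mem_par nCB Lc cC cB _ Le (parallel_sym ec) eB).
exact/par_flipr/df.
Qed.

(** The point [D] of the construction is [A +v B]. *)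
Lemma sum_viaE A B C : l A -> l C -> ~ l B -> sum_via L l O B A C = A +v C.
Proof.
move=> lA lC nlB; have [[df tf] fO] := vaddP O A.
have lfC : l (A +v C) by apply: (dilatation_line df Ll lO) => //; rewrite fO.
have nOB : O <> B by move=> e; subst B.
rewrite /sum_via; have [b [Lb bO bB]] := line_ex O B.
rewrite (line_throughE nOB Lb bO bB).
have [l' [Ll' lB' pl]] := parallel_ex B Ll.
have [a [La aA pa]] := parallel_ex A Lb.
rewrite (parallel_throughE Ll Ll' lB' pl) (parallel_throughE Lb La aA pa).
rewrite (_ : meet_point l' a = A +v B); first exact: last_projection.
apply: meet_pointE => //.
- move=> e; subst a; apply: nlB.
  have pbl := parallel_trans Lb Ll' Ll (parallel_sym pa) pl.
  by rewrite -(parallel_eq pbl bO lO).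
- have [<-|nA] := EM (O = A); first by rewrite vadd0v.
  apply: (mem_par nA Ll lO lA _ Ll' (parallel_sym pl) lB'); exact: vadd_par0.
- apply: (mem_par nOB Lb bO bB _ La (parallel_sym pa) aA); exact: vadd_parr.
Qed.

(** The point [E] of the construction is [f B]. *)
Lemma prod_viaE f B C : dilatation f -> f O = O -> l (f I) -> l C -> ~ l B ->
  prod_via L l O I B (f I) C = f C.
Proof.
move=> df fO lfI lC nlB.
have lfC : l (f C) by apply: (dilatation_line df Ll lO) => //; rewrite fO.
have nOB : O <> B by move=> e; subst B.
have nIB : I <> B by move=> e; subst B.
have nCB : C <> B by move=> e; subst B.
rewrite /prod_via; have [b [Lb bO bB]] := line_ex O B.
have [i [Li iI iB]] := line_ex I B.
rewrite (line_throughE nOB Lb bO bB) (line_throughE nIB Li iI iB).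
have [a [La aA pa]] := parallel_ex (f I) Li.
rewrite (parallel_throughE Li La aA pa).
have -> : line_through L B C = line_through L C B.
  have [c [Lc cC cB]] := line_ex C B.
  by rewrite (line_throughE nCB Lc) // (line_throughE (nesym nCB) Lc).
rewrite (_ : meet_point a b = f B); first exact: last_projection.
apply: meet_pointE => //.
- move=> e; subst a; apply: nlB; have ebi := parallel_eq pa bB iB; subst i.
  by rewrite (line_eq nOI Ll Lb).
- exact: (mem_par nIB Li iI iB (df I B) La (parallel_sym pa) aA).
- by apply: (dilatation_line df Lb bO) => //; rewrite fO.
Qed.

Lemma line_addE A C : l A -> l C -> line_add L l O A C = A +v C.
Proof.
move=> lA lC; have [B nlB] := point_off_line Ll.
apply: get_unique; first by exists B => //; rewrite sum_viaE.
by move=> Y [B' nlB' ->]; rewrite sum_viaE.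
Qed.

(** For [A = O] this is the constant map with value [O]. *)
Definition homothety A : P -> P :=
  get [set f | [/\ dilatation f, f O = O & f I = A]].

Lemma homothetyP A : l A ->
  [/\ dilatation (homothety A), homothety A O = O & homothety A I = A].
Proof.
by move=> lA; apply: (getPex (dilatation_ex nOI _)); exact: (par_line Ll).
Qed.

Lemma homothety_eq f A : l A -> dilatation f -> f O = O -> f I = A ->
  homothety A = f.
Proof.
move=> lA df fO fI; have [dd dO dI] := homothetyP lA.
by apply: (dilatation_ext dd df nOI); rewrite ?dO ?dI.
Qed.

Lemma line_mulE A C : l A -> l C -> line_mul L l O I A C = homothety A C.
Proof.
move=> lA lC; have [B nlB] := point_off_line Ll.
have [df fO fI] := homothetyP lA.
have E B' : ~ l B' -> prod_via L l O I B' A C = homothety A C.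
  by move=> nlB'; rewrite -{1}fI prod_viaE // fI.
apply: get_unique; first by exists B => //; rewrite E.
by move=> Y [B' nlB' ->]; rewrite E.
Qed.

Lemma line_vadd A B : l A -> l B -> l (A +v B).
Proof.
move=> lA lB; apply: (dilatation_line (vadd_dil O A) Ll lO) => //.
by rewrite vaddv0.
Qed.

Lemma line_homothety A B : l A -> l B -> l (homothety A B).
Proof.
move=> lA lB; have [df fO fI] := homothetyP lA.
by apply: (dilatation_line df Ll lO) => //; rewrite fO.
Qed.

Lemma homothety_inv A : l A -> A <> O ->
  exists2 B, l B & homothety A B = I /\ homothety B A = I.
Proof.
move=> lA nA; have [df fO fI] := homothetyP lA.
have [g [dg gO gA]] := dilatation_ex (nesym nA) (par_line Ll lO lA lO lI).
have lg : l (g I).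
  by apply: (dilatation_line dg Ll lO) => //; rewrite gO.
exists (g I) => //; rewrite (homothety_eq lg dg gO erefl); split=> //.
have dfg := dilatation_comp df dg.
have e : homothety A \o g = id.
  by apply: (dilatation_ext dfg dilatation_id (nesym nA)); rewrite /= ?gO ?gA.
by have := f_equal (fun h => h I) e.
Qed.

Lemma dilatation_skew_field : skew_field l O I (vadd O) homothety.
Proof.
split=> //.
- exact: line_vadd.
- exact: line_homothety.
- by move=> x y z _ _ _; exact: vaddA.
- by move=> x y _ _; exact: vaddC.
- by move=> x _; exact: vadd0v.
- move=> x lx; have [y exy] := vopp_ex O x; exists y => //.
  apply: (mem_col nOI Ll lO lI); apply: (vopp_col _ exy).
  exact: (par_line Ll).
- move=> x y z lx ly lz.
  have [[dx xO xI] [dy yO yI]] := (homothetyP lx, homothetyP ly).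
  rewrite (@homothety_eq (homothety x \o homothety y) (homothety x y)) //=.
  + exact: line_homothety.
  + exact: dilatation_comp.
  + by rewrite yO.
  + by rewrite yI.
- move=> x lx; split; last by have [] := homothetyP lx.
  by rewrite (homothety_eq lI dilatation_id).
- move=> x y z lx ly lz.
  have [[dx xO xI] [dy yO yI]] := (homothetyP lx, homothetyP ly).
  rewrite (@homothety_eq (fun X => homothety x X +v homothety y X) (x +v y)) //.
  + exact: line_vadd.
  + exact: dilatation_sum.
  + by rewrite xO yO vaddv0.
  + by rewrite xI yI.
- move=> x y z lx ly lz; have [dx xO xI] := homothetyP lx.
  exact: dilatation_vadd.
- exact: nesym.
- exact: homothety_inv.
Qed.

End LineOperations.
End AffinePlane.

Lemma skew_field_ext (T : Type) (K : set T) zero one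
    (add add' mul mul' : T -> T -> T) :
  (forall x y, K x -> K y -> add' x y = add x y) ->
  (forall x y, K x -> K y -> mul' x y = mul x y) ->
  skew_field K zero one add mul -> skew_field K zero one add' mul'.
Proof.
move=> eA eM [K0 K1 KD KM DA DC D0 DN MA M1 MDl MDr n10 MV].
split=> //.
- by move=> x y Kx Ky; rewrite eA //; exact: KD.
- by move=> x y Kx Ky; rewrite eM //; exact: KM.
- by move=> x y z Kx Ky Kz; rewrite !eA //; [exact: DA|exact: KD|exact: KD].
- by move=> x y Kx Ky; rewrite !eA //; exact: DC.
- by move=> x Kx; rewrite eA //; exact: D0.
- by move=> x Kx; have [y Ky e] := DN x Kx; exists y => //; rewrite eA.
- by move=> x y z Kx Ky Kz; rewrite !eM //; [exact: MA|exact: KM|exact: KM].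
- by move=> x Kx; rewrite !eM //; exact: M1.
- move=> x y z Kx Ky Kz; rewrite eA // !eM // ?eA //; first exact: MDl.
  1-3: by auto.
- move=> x y z Kx Ky Kz; rewrite eA // !eM // ?eA //; first exact: MDr.
  1-3: by auto.
- move=> x Kx nx; have [y Ky [e1 e2]] := MV x Kx nx.
  by exists y => //; rewrite !eM.
Qed.

(** * Orders compatible with the operations *)

Section OrderedLine.
Context (T : Type) (K : set T) (btw : T -> T -> T -> Prop).
Context (ol : ordered_line K btw).

Lemma btw_excl A B C : btw A B C -> ~ btw B C A /\ ~ btw C A B.
Proof.
move=> h; have [[KA KB KC] [nAB nBC nAC]] := ol_distinct ol h.
have [_ [h1 _ h3]] := ol_trichotomy ol KA KB KC nAB nBC nAC.
by split=> h'; [apply: h1|apply: h3].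
Qed.

Lemma btw_asym A B C : btw A B C -> ~ btw B A C.
Proof. by move=> h /(ol_sym ol); have [_] := btw_excl h. Qed.

(** If [O] separated [A] from [C], then [B] would lie between [O] and each of
    them, for otherwise [O] would separate [B] from [A] or [C]. The branching
    axiom then says that [A] lies between [C] and [B], or [C] between [A] and
    [B], and by transitivity [A] and [C] are on the same side of [O]. *)
Lemma same_side_trans O A B C : K B -> B <> O ->
  ~ btw A O B -> ~ btw B O C -> ~ btw A O C.
Proof.
move=> KB nBO nAB nBC h; have [[KA KO KC] [nAO nOC nAC]] := ol_distinct ol h.
have hs := ol_sym ol h.
have nAeB : A <> B by move=> e; subst B.
have nCeB : C <> B by move=> e; subst B.
have hA : btw A B O.
  have [[h1|//|/(ol_sym ol)//] _] := ol_trichotomy ol KO KA KB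
    (nesym nAO) nAeB (nesym nBO).
  have [h2 _] := ol_trans ol KC KO KA KB (nesym nOC) (nesym nAC) nCeB
    (nesym nAO) (nesym nBO) nAeB hs h1.
  by case: nBC; exact: (ol_sym ol).
have hC : btw C B O.
  have [[h1|//|//] _] := ol_trichotomy ol KO KC KB nOC nCeB (nesym nBO).
  by have [h2 _] := ol_trans ol KA KO KC KB nAO nAC nAeB
    nOC (nesym nBO) nCeB h h1.
have hC' := ol_sym ol hC.
have [h1|h1] := ol_branch ol KA KB KO KC nAeB nAO nAC nBO (nesym nCeB) nOC
  hA hC'.
  have [h2 _] := ol_trans ol KC KA KB KO (nesym nAC) nCeB (nesym nOC)
    nAeB nAO nBO h1 hA.
  exact: (btw_asym h (ol_sym ol h2)).
have [h2 _] := ol_trans ol KA KC KB KO nAC nAeB nAO nCeB (nesym nOC) nBO h1 hC.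
exact: (btw_asym hs (ol_sym ol h2)).
Qed.

Section CompatibleOrder.
Context (zero one : T) (add mul : T -> T -> T).
Context (sf : skew_field K zero one add mul).
Context (third : exists x, K x /\ x <> zero /\ x <> one).
Context (btw_add : forall x y z c, K c -> btw x y z ->
  btw (add x c) (add y c) (add z c)).
Context (btw_mul : forall x y z c, K c -> c <> zero -> btw x y z ->
  btw (mul x c) (mul y c) (mul z c)).

Let K0 := sf_zero sf.
Let K1 := sf_one sf.
Let KD := sf_add sf.
Let KM := sf_mul sf.
Let neq10 := sf_nontrivial sf.
Let btw_K A B C (h : btw A B C) := ol_distinct ol h.

Lemma sf_addv0 x : K x -> add x zero = x.
Proof. by move=> Kx; rewrite (sf_addC sf) ?(sf_add0 sf). Qed.

Lemma sf_addI x y z : K x -> K y -> K z -> add x y = add x z -> y = z.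
Proof.
move=> Kx Ky Kz e; have [x' Kx' ex] := sf_opp sf Kx.
rewrite -(sf_add0 sf Ky) -(sf_add0 sf Kz) -ex (sf_addC sf Kx Kx').
by rewrite -!(sf_addA sf) // e.
Qed.

Lemma sf_mulr0 x : K x -> mul x zero = zero.
Proof.
move=> Kx; apply: (@sf_addI (mul x zero)) => //; try exact: KM.
rewrite -(sf_mulDr sf) // (sf_add0 sf) // sf_addv0 //; exact: KM.
Qed.

Lemma sf_mul0r x : K x -> mul zero x = zero.
Proof.
move=> Kx; apply: (@sf_addI (mul zero x)) => //; try exact: KM.
rewrite -(sf_mulDl sf) // (sf_add0 sf) // sf_addv0 //; exact: KM.
Qed.

(** In characteristic two the translations by [p], [q] and [p + q] permute the
    four points [zero], [p], [q], [p + q] transitively, whereas an order on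
    four points distinguishes its two extremal points. *)
Lemma double_neq0 x : K x -> x <> zero -> add x x <> zero.
Proof.
move=> Kx nx exx.
have e11 : add one one = zero.
  have [y Ky [exy eyx]] := sf_inv sf Kx nx.
  by rewrite -eyx -(sf_mulDr sf) // exx sf_mulr0.
have dbl z : K z -> add z z = zero.
  move=> Kz; have [_ e] := sf_mul1 sf Kz.
  by rewrite -{1 2}e -(sf_mulDr sf) // e11 sf_mulr0.
have [a [b [c habc]]] : exists a b c, btw a b c.
  have [z [Kz [nz0 nz1]]] := third.
  have [[h|h|h] _] := ol_trichotomy ol K0 K1 Kz (nesym neq10) (nesym nz1)
    (nesym nz0);
    by eexists; eexists; eexists; exact: h.
have [[Ka Kb Kc] _] := btw_K habc.
have [p [q h]] : exists p q, btw zero p q.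
  by exists (add b a), (add c a); rewrite -(dbl a) //; exact: btw_add.
have [[_ Kp Kq] [n0p npq n0q]] := btw_K h.
have Kqp := KD Kq Kp.
have hp : btw p zero (add q p).
  by rewrite -{1}(sf_add0 sf Kp) -{2}(dbl p Kp); exact: btw_add.
have [_ [np0 n0qp npqp]] := btw_K hp.
have nqqp : q <> add q p.
  by rewrite -{1}(sf_addv0 Kq) => /(sf_addI Kq K0 Kp).
have [_ h1] := ol_trans ol Kq Kp K0 Kqp (nesym npq) (nesym n0q) nqqp np0 npqp
  n0qp (ol_sym ol h) hp.
have eqp : add (add q p) q = p.
  rewrite -(sf_addA sf) // (sf_addC sf Kp Kq) (sf_addA sf) // dbl //.
  exact: (sf_add0 sf).
have := btw_add Kq h1; rewrite dbl // (sf_add0 sf) // eqp => /(ol_sym ol) h2.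
by have [] := btw_excl h.
Qed.

(** Multiplication by [m], the opposite of [one], exchanges [x] and its opposite
    [n]; so neither of them can be the middle one of [n], [zero], [x]. *)
Lemma opposite_sides x : K x -> x <> zero ->
  exists n, [/\ K n, add x n = zero & btw n zero x].
Proof.
move=> Kx nx; have [m Km em] := sf_opp sf K1.
have Kn := KM Kx Km.
have nm : m <> zero.
  by move=> e; apply: neq10; rewrite -em e sf_addv0.
have en : add x (mul x m) = zero.
  have [_ {1}<-] := sf_mul1 sf Kx.
  by rewrite -(sf_mulDr sf) // em sf_mulr0.
have emm : mul m m = one.
  apply: (@sf_addI m) => //; first exact: KM.
  rewrite (sf_addC sf Km K1) em; have [_ {1}<-] := sf_mul1 sf Km.
  by rewrite -(sf_mulDr sf) // em sf_mulr0.
exists (mul x m); split=> //; set n := mul x m in Kn en *.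
have enm : mul n m = x.
  by rewrite /n -(sf_mulA sf) // emm; case: (sf_mul1 sf Kx).
have nn0 : n <> zero by move=> e; apply: nx; rewrite -en e sf_addv0.
have nnx : n <> x by move=> e; apply: (double_neq0 Kx nx); rewrite -{2}e.
have [[//|h|h] _] := ol_trichotomy ol Kn K0 Kx nn0 (nesym nx) nnx.
- have := btw_mul Km nm h; rewrite sf_mul0r // enm -/n => /(ol_sym ol) h'.
  by have [] := btw_excl h.
- have := btw_mul Km nm h; rewrite sf_mul0r // enm -/n => h'.
  by have := btw_asym h h'.
Qed.

Let pos := positive_points K btw zero one.

Lemma positive_pointsP x : pos x <-> [/\ K x, x <> zero & ~ btw x zero one].
Proof.
split=> [[->|[Kx h]]|[Kx nx0 nx]].
- by split=> // h; have [_ []] := btw_K h.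
- split=> // [e|h'].
    by case: h => h; have [_ []] := btw_K h; rewrite e.
  case: h => h; first exact: (btw_asym h h').
  by have [] := btw_excl h => _; apply.
have [->|nx1] := EM (x = one); first by left.
right; split=> //.
have [[h|h|//] _] := ol_trichotomy ol K0 K1 Kx (nesym neq10) (nesym nx1)
  (nesym nx0).
- by right.
- by left; exact: (ol_sym ol).
Qed.

Lemma positive_same_side x y : pos x -> pos y -> ~ btw x zero y.
Proof.
move=> /positive_pointsP [Kx nx px] /positive_pointsP [Ky ny py].
by apply: (same_side_trans K1 neq10 px) => /(ol_sym ol).
Qed.

Lemma positive_add x y : pos x -> pos y -> pos (add x y).
Proof.
move=> hx hy; have nyx := positive_same_side hy hx.
have [Kx nx px] := (positive_pointsP x).1 hx.
have [Ky ny _] := (positive_pointsP y).1 hy.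
have [n [Kn en hn]] := opposite_sides Kx nx.
have [_ [nn0 _ nnx]] := btw_K hn.
have Kxy := KD Kx Ky.
apply/positive_pointsP; split=> //.
  by rewrite -en => /(sf_addI Kx Ky Kn) e; apply: nyx; rewrite e.
apply: (same_side_trans Kx nx _ px) => h.
have := btw_add Kn h; rewrite (sf_add0 sf) // en.
rewrite (sf_addC sf Kx Ky) -(sf_addA sf) // en sf_addv0 // => h1.
have [_ [nyn _ ny0]] := btw_K h1.
have [eyx|nyex] := EM (y = x).
  by rewrite eyx in h1; have [_] := btw_excl hn.
by have [] := ol_trans ol Ky Kn K0 Kx nyn ny0 nyex nn0 nnx (nesym nx) h1 hn.
Qed.

Lemma positive_mul x y : pos x -> pos y -> pos (mul x y).
Proof.
move=> /positive_pointsP [Kx nx px] /positive_pointsP [Ky ny py].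
have [z Kz [eyz ezy]] := sf_inv sf Ky ny.
have exyz : mul (mul x y) z = x.
  by rewrite -(sf_mulA sf) // eyz; case: (sf_mul1 sf Kx).
apply/positive_pointsP; split; first exact: KM.
  by move=> e; apply: nx; rewrite -exyz e sf_mul0r.
apply: (same_side_trans Ky ny _ py) => h; apply: px.
have nz : z <> zero by move=> e; apply: neq10; rewrite -eyz e sf_mulr0.
by have := btw_mul Kz nz h; rewrite exyz sf_mul0r // eyz.
Qed.

Theorem ordered_skew_field_of_btw : ordered_skew_field K zero one add mul
  (positive_points K btw zero one) (negative_points K btw zero one).
Proof.
split=> //.
- apply/seteqP; split=> x /=.
    move=> Kx; have [->|nx] := EM (x = zero); first by left; right.
    have [h|h] := EM (btw x zero one); first by left; left.
    by right; apply/positive_pointsP.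
  by move=> [[[]|->]|/positive_pointsP []].
- split; apply/seteqP; split=> x //=.
  + by move=> [[_ h] e]; have [_ []] := btw_K h; rewrite e.
  + by move=> [-> /positive_pointsP []].
  + by move=> [[_ h] /positive_pointsP []].
- exact: positive_add.
- exact: positive_mul.
Qed.

End CompatibleOrder.
End OrderedLine.

(** * Sums and products as parallel projections *)

Section ParallelProjections.
Context (P : pointedType) (L : set (set P)).
Context (btw : set P -> P -> P -> P -> Prop).
Context (hplane : ordered_desargues_affine_plane L btw).

Let ap : affine_plane L. Proof. by case: hplane => [[]]. Qed.

Lemma btw_projection l1 l2 d A B C : L l1 -> L l2 -> L d ->
  ~ parallel d l1 -> ~ parallel d l2 -> btw l1 A B C ->
  btw l2 (parallel_projection L d l2 A) (parallel_projection L d l2 B)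
    (parallel_projection L d l2 C).
Proof.
case: hplane => _ ol pr L1 L2 Ld n1 n2 h.
by case: (pr l1 l2 d L1 L2 Ld n1 n2 A B C h) => // /(ol_sym (ol l2 L2)).
Qed.

Context (l : set P) (Ll : L l).

Lemma transversal d A B : L d -> l A -> d A -> d B -> ~ l B -> ~ parallel d l.
Proof.
by move=> Ld lA dA dB nlB pd; apply: nlB; rewrite -(parallel_eq pd dA lA).
Qed.

Lemma sum_via_btw O B C X Y Z : l O -> l C -> ~ l B -> btw l X Y Z ->
  btw l (sum_via L l O B X C) (sum_via L l O B Y C) (sum_via L l O B Z C).
Proof.
move=> lO lC nlB h.
have nOB : O <> B by move=> e; subst B.
have nCB : C <> B by move=> e; subst B.
have [b [Lb bO bB]] := line_ex ap O B; have [c [Lc cC cB]] := line_ex ap C B.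
have [l' [Ll' lB' pl]] := parallel_ex ap B Ll.
have nl' d A : L d -> l A -> d A -> d B -> ~ parallel d l'.
  move=> Ld lA dA dB pd; apply: (transversal Ld lA dA dB nlB).
  exact: (parallel_trans ap Ld Ll' Ll pd pl).
rewrite /sum_via (line_throughE ap nOB Lb bO bB).
rewrite (line_throughE ap nCB Lc cC cB).
rewrite (parallel_throughE ap Ll Ll' lB' pl).
apply: (btw_projection Ll' Ll Lc (nl' c C Lc lC cC cB)
  (transversal Lc lC cC cB nlB)).
exact: (btw_projection Ll Ll' Lb (transversal Lb lO bO bB nlB)
  (nl' b O Lb lO bO bB) h).
Qed.

Lemma prod_via_btw O I B C X Y Z : l O -> l I -> O <> I -> l C -> C <> O ->
  ~ l B -> btw l X Y Z ->
  btw l (prod_via L l O I B X C) (prod_via L l O I B Y C)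
    (prod_via L l O I B Z C).
Proof.
move=> lO lI nOI lC nCO nlB h.
have nOB : O <> B by move=> e; subst B.
have nIB : I <> B by move=> e; subst B.
have nBC : B <> C by move=> e; subst B.
have [b [Lb bO bB]] := line_ex ap O B; have [c [Lc cB cC]] := line_ex ap B C.
have [i [Li iI iB]] := line_ex ap I B.
rewrite /prod_via (line_throughE ap nOB Lb bO bB).
rewrite (line_throughE ap nBC Lc cB cC).
rewrite (line_throughE ap nIB Li iI iB).
(* The construction intersects in the order opposite to that of a projection. *)
rewrite ![meet_point _ b]/meet_point ![_ `&` b]setIC.
have nb d A : L d -> l A -> A <> O -> d A -> d B -> ~ parallel d b.
  move=> Ld lA nAO dA dB pd; apply: nlB.
  have e := parallel_eq pd dB bB; subst d.
  by rewrite (line_eq ap nAO Ll Lb).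
apply: (btw_projection Lb Ll Lc (nb c C Lc lC nCO cC cB)
  (transversal Lc lC cC cB nlB)).
exact: (btw_projection Ll Lb Li (transversal Li lI iI iB nlB)
  (nb i I Li lI (nesym nOI) iI iB) h).
Qed.

End ParallelProjections.

Theorem theorem6 (P : pointedType) (L : set (set P))
    (btw : set P -> P -> P -> P -> Prop)
    (hplane : ordered_desargues_affine_plane L btw)
    (l : set P) (hl : L l) (O I : P) (hO : l O) (hI : l I) (hOI : O <> I)
    (* excludes the plane of order 2, for which the conclusion is false *)
    (hthird : exists X : P, l X /\ X <> O /\ X <> I) :
  ordered_skew_field l O I (line_add L l O) (line_mul L l O I)
    (positive_points l (btw l) O I) (negative_points l (btw l) O I).
Proof.
have [[ap de] ol _] := hplane.
have off_two : forall m n, L m -> L n -> exists Z, ~ m Z /\ ~ n Z.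
  have [X [lX [nXO nXI]]] := hthird.
  exact: (point_off_two_lines ap hl hO hI lX hOI nXO nXI).
have addE := line_addE ap de off_two hl hO.
have mulE := line_mulE ap de off_two hl hO hI hOI.
have sumE := sum_viaE ap de off_two hl hO.
have [B nlB] := point_off_line ap hl.
apply: (@ordered_skew_field_of_btw _ _ _ (ol l hl)) => //.
- apply: (skew_field_ext addE mulE).
  exact: (dilatation_skew_field ap de off_two hl hO hI hOI).
- move=> x y z c lc h; have [[lx ly lz] _] := ol_distinct (ol l hl) h.
  rewrite !addE // -(sumE x B c) // -(sumE y B c) // -(sumE z B c) //.
  exact: (sum_via_btw hplane).
- move=> x y z c lc nc h; have [[lx ly lz] _] := ol_distinct (ol l hl) h.
  have E w : l w -> line_mul L l O I w c = prod_via L l O I B w c.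
    move=> lw; rewrite mulE //.
    have [df fO fI] := homothetyP ap de off_two hl hO hI hOI lw.
    by rewrite -{2}fI (prod_viaE ap hl hO hI hOI df fO) // fI.
  by rewrite !E //; exact: (prod_via_btw hplane).
Qed.
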